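(* Let $a,b,c,k$ be positive integers. If each of the graphs $K_{a,b,c}$, $K_{5k,b,c}$, $K_{b,5k,5k}$, $K_{a,5k,5k}$, and $K_{c,5k,5k}$ can be decomposed into $5$-cycles, then $K_{a+10k,\,2b+5k,\,2c+5k}$ can also be decomposed into $5$-cycles.
   Context: $K_{r,s,t}$ denotes the complete tripartite graph with parts of sizes $r,s,t$ (no ordering of $r,s,t$ is assumed). A decomposition of a graph into $5$-cycles is a partition of its edge set into edge sets of cycles of length $5$. *)

(* Defs.v *)
From mathcomp Require Import all_boot.
Set Implicit Arguments.
Unset Strict Implicit.
Unset Printing Implicit Defensive.

(* A simple graph is a symmetric irreflexive relation on a finite vertex type;
   its edges are unordered pairs, i.e. two-element sets of vertices. *)
Definition edge_set (T : finType) (e : rel T) : {set {set T}} :=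
  [set [set p.1; p.2] | p : T * T & e p.1 p.2].

Definition cycle_edges (T : finType) (c : seq T) : {set {set T}} :=
  [set [set x; next c x] | x in c].

(* Meaningful for 3 <= n: ucycle also accepts closed walks of length 1 and 2. *)
Definition is_cycle_edge_set (T : finType) (e : rel T) (n : nat)
    (C : {set {set T}}) : Prop :=
  exists c : n.-tuple T, ucycle e c /\ C = cycle_edges c.

Definition cycle_decomposable (T : finType) (e : rel T) (n : nat) : Prop :=
  exists P : {set {set {set T}}},
    partition P (edge_set e) /\
    (forall C, C \in P -> is_cycle_edge_set e n C).

Definition tripartite_vertex (r s t : nat) : finType :=
  ('I_r + 'I_s + 'I_t)%type.

Definition complete_tripartite (r s t : nat) : rel (tripartite_vertex r s t) :=
  fun x y =>
    match x, y with
    | inl (inl _), inl (inl _) => false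
    | inl (inr _), inl (inr _) => false
    | inr _, inr _ => false
    | _, _ => true
    end.

Lemma complete_tripartite_sym (r s t : nat) :
  symmetric (@complete_tripartite r s t).
Proof. by move=> [[x|x]|x] [[y|y]|y]. Qed.

Lemma complete_tripartite_irr (r s t : nat) :
  irreflexive (@complete_tripartite r s t).
Proof. by move=> [[x|x]|x]. Qed.

(* Main.v *)
Require Import Defs.
From mathcomp Require Import all_boot.

(** The construction is the Latin-square blow-up.  Split each of the three
    parts of [K_{a+10k, 2b+5k, 2c+5k}] into three blocks, of sizes
    [(a, 5k, 5k)], [(b, b, 5k)] and [(c, c, 5k)].  A Latin square of order 3,
    read as a set of nine triples (row, column, symbol), chooses nine triples of
    blocks, one from each part, such that any two blocks lying in different
    parts occur together in exactly one triple.  Hence the nine complete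
    tripartite graphs spanned by these triples partition the edges of the
    large graph, and 5-cycle decompositions of the nine pieces assemble into
    one of the whole ([tripartite_latin_square]).

    The Latin square is the addition table of the integers mod 3, which gives
    - row [a]: [K_{a,b,c}] twice (symbols equal to columns), and [K_{a,5k,5k}];
    - first row [5k]: [K_{5k,b,c}], [K_{5k,b,5k}], [K_{5k,5k,c}];
    - second row [5k]: [K_{5k,b,5k}], [K_{5k,b,c}], [K_{5k,5k,c}].
    Up to the order of the parts each piece is one of the five given graphs.

    Gluing ([cycle_decomposable_glue]) is stated for a family of injective
    graph homomorphisms whose images partition the edges; with a one-element
    family it also transports decompositions along isomorphisms, which takes
    care of reordering the parts and of renaming the vertices. *)

Set Implicit Arguments.
Unset Strict Implicit.
Unset Printing Implicit Defensive.

Lemma edge_setP (T : finType) (e : rel T) (E : {set T}) :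
  reflect (exists x y, e x y /\ E = [set x; y]) (E \in edge_set e).
Proof.
apply: (iffP imsetP) => [[[x y] /=] | [x [y [exy ->]]]].
  by rewrite inE /= => exy ->; exists x, y.
by exists (x, y); rewrite ?inE.
Qed.

Lemma set2_eqP (T : finType) (x y u v : T) :
  [set x; y] = [set u; v] -> (x = u /\ y = v) \/ (x = v /\ y = u).
Proof.
move=> E.
have: x \in [set u; v] by rewrite -E set21.
have: y \in [set u; v] by rewrite -E set22.
have: u \in [set x; y] by rewrite E set21.
have: v \in [set x; y] by rewrite E set22.
by rewrite !inE; do 4 case/orP=> /eqP ?; subst; auto.
Qed.

Definition edges_image (S T : finType) (f : S -> T) (X : {set {set S}}) :
    {set {set T}} :=
  [set f @: (E : {set S}) | E in X].

Lemma edges_imageP (S T : finType) (d : rel S) (f : S -> T) (E : {set T}) :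
  reflect (exists x y, d x y /\ E = [set f x; f y])
          (E \in edges_image f (edge_set d)).
Proof.
apply: (iffP imsetP) => [[E' /edge_setP[x [y [dxy ->]]] ->] | [x [y [dxy ->]]]].
  by exists x, y; rewrite imsetU !imset_set1.
by exists [set x; y]; [apply/edge_setP; exists x, y | rewrite imsetU !imset_set1].
Qed.

Lemma cycle_edge_set_image (S T : finType) (d : rel S) (e : rel T)
    (f : S -> T) (n : nat) (C : {set {set S}}) :
    injective f -> {homo f : x y / d x y >-> e x y} ->
  is_cycle_edge_set d n C ->
  is_cycle_edge_set e n (edges_image f C).
Proof.
move=> f_inj f_hom [c [/andP[c_cyc c_uniq] ->]].
exists [tuple of map f c]; split.
  by rewrite /ucycle (homo_cycle f_hom) //= map_inj_uniq.
rewrite /edges_image /cycle_edges -imset_comp; apply/setP=> E.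
apply/imsetP/imsetP => [[x cx ->] | [y /mapP[x cx ->] ->]].
  by exists (f x); rewrite ?map_f //= imsetU !imset_set1 next_map.
by exists x; rewrite //= imsetU !imset_set1 next_map.
Qed.

(** Decompositions of the pieces are pushed forward and collected.  The last
    hypothesis compares ordered pairs; symmetry of the pieces makes this enough
    for edges, which are unordered. *)
Lemma cycle_decomposable_glue (I T : finType) (e : rel T) (S : I -> finType)
    (d : forall i, rel (S i)) (f : forall i, S i -> T) (n : nat) :
    (forall i, symmetric (d i)) ->
    (forall i, injective (f i)) ->
    (forall i, {homo f i : x y / d i x y >-> e x y}) ->
    (forall x y, e x y -> exists i u v, [/\ d i u v, x = f i u & y = f i v]) ->
    (forall i j u v u' v', d i u v -> d j u' v' ->
       f i u = f j u' -> f i v = f j v' -> i = j) ->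
    (forall i, cycle_decomposable (d i) n) ->
  cycle_decomposable e n.
Proof.
move=> d_sym f_inj f_hom e_cov e_disj /fin_all_exists[P P_dec].
pose Q i := [set edges_image (f i) C | C in P i].
pose D i := edges_image (f i) (edge_set (d i)).
have QD i : partition (Q i) (D i).
  by rewrite imset_partition; [case: (P_dec i) | apply: imset_inj].
have D_disj i j E : E \in D i -> E \in D j -> i = j.
  case/edges_imageP=> u [v [duv ->]] /edges_imageP[u' [v' [duv' /set2_eqP]]].
  case=> [] [E1 E2]; first exact: e_disj duv duv' E1 E2.
  by rewrite d_sym in duv'; apply: e_disj duv duv' E1 E2.
exists (\bigcup_i Q i); split; last first.
  move=> C /bigcupP[i _ /imsetP[C' C'P ->]].
  by apply: cycle_edge_set_image (f_inj i) (f_hom i) _; case: (P_dec i) => _; apply.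
apply/and3P; split.
- apply/eqP/setP=> E; apply/bigcupP/edge_setP.
    case=> C /bigcupP[i _ CQ] EC.
    have /edges_imageP[u [v [duv ->]]]: E \in D i.
      exact: (subsetP (partitionS (QD i) CQ)).
    by exists (f i u), (f i v); split=> //; apply: f_hom.
  case=> x [y [/e_cov[i [u [v [duv -> ->]]]] ->]].
  have: [set f i u; f i v] \in D i.
    by apply/edges_imageP; exists u, v.
  rewrite -(cover_partition (QD i)) => /bigcupP[C CQ EC].
  by exists C => //; apply/bigcupP; exists i.
- apply/trivIsetP=> C C' /bigcupP[i _ CQ] /bigcupP[j _ CQ'] neqC.
  have [eq_ij | neq_ij] := eqVneq i j.
    subst j; exact: (trivIsetP (partition_trivIset (QD i))).
  rewrite -setI_eq0; apply/set0Pn=> -[E /setIP[EC EC']].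
  case/eqP: neq_ij; apply: (D_disj _ _ E).
    exact: (subsetP (partitionS (QD i) CQ)).
  exact: (subsetP (partitionS (QD j) CQ')).
- by apply/bigcupP=> -[i _]; rewrite (partition0 (QD i)).
Qed.

Lemma cycle_decomposable_iso (S T : finType) (d : rel S) (e : rel T)
    (f : S -> T) (n : nat) :
    symmetric d -> bijective f -> {mono f : x y / d x y >-> e x y} ->
  cycle_decomposable d n -> cycle_decomposable e n.
Proof.
move=> d_sym [g fK gK] f_mono dec.
apply: (@cycle_decomposable_glue unit _ _ (fun=> S) (fun=> d) (fun=> f)) => //.
- by move=> _; apply: can_inj fK.
- by move=> _ x y; rewrite f_mono.
- by move=> x y exy; exists tt, (g x), (g y); rewrite -f_mono !gK.
- by case=> -[].
Qed.

(** [complete_tripartite] with arbitrary finite types as parts, so that a part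
    can be a disjoint union of blocks; on ordinal parts the two are
    convertible. *)
Definition tripartite (A B C : finType) : rel (A + B + C)%type :=
  fun x y =>
    match x, y with
    | inl (inl _), inl (inl _) => false
    | inl (inr _), inl (inr _) => false
    | inr _, inr _ => false
    | _, _ => true
    end.
Arguments tripartite : clear implicits.

Lemma tripartite_sym (A B C : finType) : symmetric (tripartite A B C).
Proof. by move=> [[x|x]|x] [[y|y]|y]. Qed.

Lemma bijective_of_card (A A' : finType) :
  #|A| = #|A'| -> exists f : A -> A', bijective f.
Proof.
move=> eqA; exists (fun x => enum_val (cast_ord eqA (enum_rank x))).
exists (fun y => enum_val (cast_ord (esym eqA) (enum_rank y))) => x.
  by rewrite enum_valK cast_ordK enum_rankK.
by rewrite enum_valK cast_ordKV enum_rankK.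
Qed.

Lemma tripartite_card (A B C A' B' C' : finType) (n : nat) :
    #|A| = #|A'| -> #|B| = #|B'| -> #|C| = #|C'| ->
  cycle_decomposable (tripartite A B C) n ->
  cycle_decomposable (tripartite A' B' C') n.
Proof.
move=> /bijective_of_card[f [f' fK f'K]] /bijective_of_card[g [g' gK g'K]].
move=> /bijective_of_card[h [h' hK h'K]].
pose F (x : A + B + C) : A' + B' + C' := match x with
  | inl (inl x) => inl (inl (f x)) | inl (inr x) => inl (inr (g x))
  | inr x => inr (h x) end.
apply: (@cycle_decomposable_iso _ _ _ _ F); first exact: tripartite_sym.
  exists (fun x => match x with
    | inl (inl x) => inl (inl (f' x)) | inl (inr x) => inl (inr (g' x))
    | inr x => inr (h' x) end) => [] [[x|x]|x] /=; congruence.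
by move=> [[x|x]|x] [[y|y]|y].
Qed.

Lemma tripartite_swap12 (A B C : finType) (n : nat) :
  cycle_decomposable (tripartite A B C) n ->
  cycle_decomposable (tripartite B A C) n.
Proof.
pose F (A B : finType) (x : A + B + C) : B + A + C := match x with
  | inl (inl x) => inl (inr x) | inl (inr x) => inl (inl x)
  | inr x => inr x end.
apply: (@cycle_decomposable_iso _ _ _ _ (F A B)); first exact: tripartite_sym.
  by exists (F B A) => [] [[x|x]|x].
by move=> [[x|x]|x] [[y|y]|y].
Qed.

Lemma tripartite_swap23 (A B C : finType) (n : nat) :
  cycle_decomposable (tripartite A B C) n ->
  cycle_decomposable (tripartite A C B) n.
Proof.
pose F (B C : finType) (x : A + B + C) : A + C + B := match x with
  | inl (inl x) => inl (inl x) | inl (inr x) => inr x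
  | inr x => inl (inr x) end.
apply: (@cycle_decomposable_iso _ _ _ _ (F B C)); first exact: tripartite_sym.
  by exists (F C B) => [] [[x|x]|x].
by move=> [[x|x]|x] [[y|y]|y].
Qed.

(** The two injectivity hypotheses say that [L] is a Latin square.  An edge
    between blocks of parts 1 and 2 fixes the cell [(i, j)] outright; one between
    parts 1 and 3 fixes the row [i] and the symbol, hence the column; one
    between parts 2 and 3 fixes the column and the symbol, hence the row. *)
Lemma tripartite_latin_square (I : finType) (L : I -> I -> I)
    (A B C : I -> finType) (n : nat) :
    (forall i, injective (L i)) -> (forall j, injective (L^~ j)) ->
    (forall i j, cycle_decomposable (tripartite (A i) (B j) (C (L i j))) n) ->
  cycle_decomposable
    (tripartite {i : I & A i} {j : I & B j} {l : I & C l}) n.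
Proof.
move=> L_row L_col dec.
pose S (p : I * I) : finType := (A p.1 + B p.2 + C (L p.1 p.2))%type.
pose f (p : I * I) (x : S p) :
    {i : I & A i} + {j : I & B j} + {l : I & C l} := match x with
  | inl (inl x) => inl (inl (Tagged A x)) | inl (inr x) => inl (inr (Tagged B x))
  | inr x => inr (Tagged C x) end.
apply: (@cycle_decomposable_glue _ _ _ S
          (fun p => tripartite (A p.1) (B p.2) (C (L p.1 p.2))) f).
- by move=> p; apply: tripartite_sym.
- by move=> [i j] [[x|x]|x] [[y|y]|y] //= [] /eqP; rewrite eq_Tagged => /eqP /= ->.
- by move=> p [[x|x]|x] [[y|y]|y].
- have AB i j (x : A i) (y : B j) : exists p u v,
      f p (inl (inl u)) = inl (inl (Tagged A x))
      /\ f p (inl (inr v)) = inl (inr (Tagged B y)).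
    by exists (i, j), x, y.
  have AC i l (x : A i) (z : C l) : exists p u v,
      f p (inl (inl u)) = inl (inl (Tagged A x))
      /\ f p (inr v) = inr (Tagged C z).
    have /codomP[j El] := injF_onto (L_row i) l.
    by subst l; exists (i, j), x, z.
  have BC j l (y : B j) (z : C l) : exists p u v,
      f p (inl (inr u)) = inl (inr (Tagged B y))
      /\ f p (inr v) = inr (Tagged C z).
    have /codomP[i El] := injF_onto (L_col j) l.
    by subst l; exists (i, j), y, z.
  move=> [[[i x]|[i x]]|[i x]] [[[j y]|[j y]]|[j y]] // _.
  + by have [p [u [v [<- <-]]]] := AB _ _ x y; exists p, (inl (inl u)), (inl (inr v)).
  + by have [p [u [v [<- <-]]]] := AC _ _ x y; exists p, (inl (inl u)), (inr v).
  + by have [p [u [v [<- <-]]]] := AB _ _ y x; exists p, (inl (inr v)), (inl (inl u)).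
  + by have [p [u [v [<- <-]]]] := BC _ _ x y; exists p, (inl (inr u)), (inr v).
  + by have [p [u [v [<- <-]]]] := AC _ _ y x; exists p, (inr v), (inl (inl u)).
  + by have [p [u [v [<- <-]]]] := BC _ _ y x; exists p, (inr v), (inl (inr u)).
- move=> [i j] [i' j'].
  have row : i = i' -> L i j = L i' j' -> (i, j) = (i', j').
    by move=> -> /L_row ->.
  have col : j = j' -> L i j = L i' j' -> (i, j) = (i', j').
    by move=> -> /L_col ->.
  move=> [[x|x]|x] [[y|y]|y] [[x'|x']|x'] [[y'|y']|y'] //= _ _ [E1 _] [E2 _].
  (* [E1] and [E2] identify the two coordinates carried by the parts of the
     endpoints, among row, column and symbol. *)
  all: try by [rewrite E1 E2 | apply: row | apply: col].
- by case.
Qed.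

Lemma card_blocks3 (m : 'I_3 -> nat) :
  #|{: {i : 'I_3 & 'I_(m i)}}| = m (inord 0) + m (inord 1) + m (inord 2).
Proof.
rewrite card_tagged (eq_map (fun i => card_ord (m i))) sumnE big_map big_enum /=.
rewrite !big_ord_recr big_ord0 /= add0n.
by congr (m _ + m _ + m _); apply/val_inj; rewrite /= inordK.
Qed.

Theorem theorem4p5 (a b c k : nat)
    (ha : 0 < a) (hb : 0 < b) (hc : 0 < c) (hk : 0 < k)
    (habc : cycle_decomposable (@complete_tripartite a b c) 5)
    (hkbc : cycle_decomposable (@complete_tripartite (5 * k) b c) 5)
    (hbkk : cycle_decomposable (@complete_tripartite b (5 * k) (5 * k)) 5)
    (hakk : cycle_decomposable (@complete_tripartite a (5 * k) (5 * k)) 5)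
    (hckk : cycle_decomposable (@complete_tripartite c (5 * k) (5 * k)) 5) :
  cycle_decomposable
    (@complete_tripartite (a + 10 * k) (2 * b + 5 * k) (2 * c + 5 * k)) 5.
Proof.
have {}hbkk := tripartite_swap12 hbkk.
have {}hckk := tripartite_swap23 (tripartite_swap12 hckk).
pose size_of (s : seq nat) (i : 'I_3) := nth 0 s i.
pose mA := size_of [:: a; 5 * k; 5 * k].
pose mB := size_of [:: b; b; 5 * k].
pose mC := size_of [:: c; c; 5 * k].
apply: (@tripartite_card {i : 'I_3 & 'I_(mA i)} {i : 'I_3 & 'I_(mB i)}
          {i : 'I_3 & 'I_(mC i)}).
- by rewrite card_blocks3 card_ord /mA /size_of !inordK //= -addnA -mulnDl.
- by rewrite card_blocks3 card_ord /mB /size_of !inordK //= mul2n addnn.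
- by rewrite card_blocks3 card_ord /mC /size_of !inordK //= mul2n addnn.
pose add3 (i j : 'I_3) : 'I_3 := Ordinal (ltn_pmod (i + j) (isT : 0 < 3)).
apply: (@tripartite_latin_square _ add3).
- move=> i x y /(congr1 val)/eqP /=.
  by rewrite eqn_modDl !modn_small // => /eqP/val_inj.
- move=> j x y /(congr1 val)/eqP /=.
  by rewrite eqn_modDr !modn_small // => /eqP/val_inj.
by move=> [[|[|[|//]]] ?] [[|[|[|//]]] ?].
Qed.
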